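(* For an arbitrary division semiring $D$ the following is true: (1) The canonical homomorphism $\jmath \colon SK_0(D) \to K_0(D)$ is injective. (2) The homomorphism $\jmath \colon SK_0(D) \to K_0(D)$ is an isomorphism if and only if $D$ is a weakly cancellative division semiring.
   Context: A semiring $(S,+,\cdot,0,1)$ consists of a commutative monoid $(S,+,0)$ and a monoid $(S,\cdot,1)$ such that multiplication distributes over addition on both sides and $0s=0=s0$. It is a division semiring if $(S\setminus\{0\},\cdot,1)$ is a group. A division semiring $D$ is weakly cancellative if $a+a=a+b$ implies $a=b$ for all $a,b\in D$. Right $S$-semimodules are commutative monoids with a unital, biadditive, associative right action of $S$ with $0_Ms=0_M=m0$. A finitely generated projective right $S$-semimodule is a retract of $S^n$ for some $n$ (i.e. a semimodule $P$ with homomorphisms $f\colon S^n\to P$, $g\colon P\to S^n$ such that $f\circ g=\mathrm{id}_P$); a finitely generated strongly projective right $S$-semimodule is one isomorphic to a direct summand of $S^n$ for some $n$. $\mathcal{V}(S)$ (resp. $\mathcal{SV}(S)$) is the commutative monoid of isomorphism classes $\overline{P}$ of finitely generated projective (resp. strongly projective) right $S$-semimodules under $\overline{P}+\overline{Q}=\overline{P\oplus Q}$. $K_0(S)$ and $SK_0(S)$ are the Grothendieck groups of $\mathcal{V}(S)$ and $\mathcal{SV}(S)$, respectively; the class of $P$ is denoted $[P]$ in $K_0(S)$ and $\widehat{P}$ in $SK_0(S)$. The canonical homomorphism $\jmath\colon SK_0(S)\to K_0(S)$ is given by $\jmath(\widehat{P})=[P]$. *)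

(* Defs.v *)
From HB Require Import structures.
From mathcomp Require Import all_boot all_algebra.
From mathcomp Require Import boolp.

Set Implicit Arguments.
Unset Strict Implicit.
Unset Printing Implicit Defensive.

Import GRing.Theory.
Local Open Scope ring_scope.

(* The elements of [quot r] are the r-classes, seen as predicates.             *)
Section Quotient.
Variables (T : Type) (r : T -> T -> Prop).
Hypothesis r_refl : forall x, r x x.
Hypothesis r_sym : forall x y, r x y -> r y x.
Hypothesis r_trans : forall x y z, r x y -> r y z -> r x z.

Definition quot : Type := {E : T -> Prop | exists x, E = r x}.

Definition qclass (x : T) : quot :=
  exist (fun E : T -> Prop => exists x, E = r x) (r x) (ex_intro _ x erefl).

Definition qrepr (E : quot) : T := sval (cid (svalP E)).

Lemma quot_inj (E F : quot) : sval E = sval F -> E = F.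
Proof. by case: E F => [E hE] [F hF] /= eEF; apply: eq_exist. Qed.

Lemma qreprK E : qclass (qrepr E) = E.
Proof. by apply: quot_inj; rewrite [RHS](svalP (cid (svalP E))). Qed.

Lemma qclassP x y : qclass x = qclass y <-> r x y.
Proof.
split=> [/(congr1 sval)/= e | rxy].
  by move: (r_refl y); rewrite -e.
apply: quot_inj; apply/funext => z; apply/propext; split=> /=; last exact: r_trans.
by apply: r_trans; apply: r_sym.
Qed.

Lemma qrepr_class x : r (qrepr (qclass x)) x.
Proof. by apply/qclassP; rewrite qreprK. Qed.

End Quotient.

(* The isomorphism classes of semimodules form a type in a universe strictly   *)
(* larger than the one of the carriers of nmodType and zmodType, which are     *)
(* universe monomorphic. V(S), SV(S) and their Grothendieck groups therefore   *)
(* use the following structures instead of nmodType and zmodType.              *)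
Record cmonoid := CMonoid {
  cm_sort :> Type;
  cm_zero : cm_sort;
  cm_add : cm_sort -> cm_sort -> cm_sort;
  cm_addA : forall x y z, cm_add x (cm_add y z) = cm_add (cm_add x y) z;
  cm_addC : forall x y, cm_add x y = cm_add y x;
  cm_add0 : forall x, cm_add cm_zero x = x }.

Record agroup := AGroup {
  ag_monoid :> cmonoid;
  ag_opp : ag_monoid -> ag_monoid;
  ag_addN : forall x, cm_add (ag_opp x) x = cm_zero ag_monoid }.

Record cmhom (M N : cmonoid) := CMHom {
  cm_fun :> M -> N;
  cm_fun0 : cm_fun (cm_zero M) = cm_zero N;
  cm_funD : forall x y, cm_fun (cm_add x y) = cm_add (cm_fun x) (cm_fun y) }.

Definition isomorphism (M N : cmonoid) (f : cmhom M N) : Prop := bijective f.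

Section Grothendieck.
Variable M : cmonoid.
Local Notation "x + y" := (cm_add x y).
Implicit Types (x y z t : M) (p q s : M * M).

Lemma cm_addCA x y z : x + (y + z) = y + (x + z).
Proof. by rewrite !cm_addA (cm_addC x). Qed.

Lemma cm_addACA x y z t : (x + y) + (z + t) = (x + z) + (y + t).
Proof. by rewrite -!cm_addA (cm_addCA y). Qed.

(* The pair (x, y) stands for the formal difference x - y.                     *)
Definition geq p q : Prop :=
  exists z : M, (p.1 + q.2) + z = (q.1 + p.2) + z.

Lemma geq_refl p : geq p p.
Proof. by exists (cm_zero M). Qed.

Lemma geq_sym p q : geq p q -> geq q p.
Proof. by case=> z e; exists z. Qed.

Lemma geq_trans p q s : geq p q -> geq q s -> geq p s.
Proof.
case: p q s => [a b] [c d] [e f] [/= z h] [/= t k].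
have ac x y : (x + y) + ((c + d) + (z + t)) = ((x + d) + z) + ((c + y) + t).
  rewrite [RHS]cm_addACA; rewrite cm_addA; congr (_ + _).
  by rewrite (cm_addC c d) cm_addACA (cm_addC y c).
exists ((c + d) + (z + t)) => /=.
by rewrite !ac h k cm_addACA (cm_addC (c + b)) -cm_addACA.
Qed.

Definition pair_add p q : M * M := (p.1 + q.1, p.2 + q.2).

Lemma geq_add p p' q q' :
  geq p p' -> geq q q' -> geq (pair_add p q) (pair_add p' q').
Proof.
case=> z h [t k]; exists (z + t) => /=.
by rewrite (cm_addACA p.1) (cm_addACA p'.1) cm_addACA h k cm_addACA.
Qed.

Definition grot := quot geq.
Definition grot_class : M * M -> grot := @qclass _ geq.

Lemma grot_classP p q : grot_class p = grot_class q <-> geq p q.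
Proof. exact: (qclassP geq_refl geq_sym geq_trans). Qed.

Definition grot_zero : grot := grot_class (cm_zero M, cm_zero M).
Definition grot_add (u v : grot) : grot :=
  grot_class (pair_add (qrepr u) (qrepr v)).
Definition grot_opp (u : grot) : grot :=
  grot_class ((qrepr u).2, (qrepr u).1).

Lemma grot_ind (P : grot -> Prop) : (forall p, P (grot_class p)) -> forall u, P u.
Proof. by move=> h u; rewrite -(qreprK u); apply: h. Qed.

Lemma grot_addE p q :
  grot_add (grot_class p) (grot_class q) = grot_class (pair_add p q).
Proof.
by apply/grot_classP/geq_add; apply: (qrepr_class geq_refl geq_sym geq_trans).
Qed.

Lemma grot_oppE p : grot_opp (grot_class p) = grot_class (p.2, p.1).
Proof.
apply/grot_classP.
have [z h] := qrepr_class geq_refl geq_sym geq_trans p.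
exists z => /=; rewrite (cm_addC _ p.1) (cm_addC p.2); exact: esym.
Qed.

Lemma grot_addA u v w :
  grot_add u (grot_add v w) = grot_add (grot_add u v) w.
Proof.
elim/grot_ind: u => p; elim/grot_ind: v => q; elim/grot_ind: w => s.
by rewrite !grot_addE /pair_add /= !cm_addA.
Qed.

Lemma grot_addC u v : grot_add u v = grot_add v u.
Proof.
elim/grot_ind: u => p; elim/grot_ind: v => q.
by rewrite !grot_addE /pair_add (cm_addC p.1) (cm_addC p.2).
Qed.

Lemma grot_add0 u : grot_add grot_zero u = u.
Proof. by elim/grot_ind: u => -[x y]; rewrite grot_addE /pair_add /= !cm_add0. Qed.

Lemma grot_addN u : grot_add (grot_opp u) u = grot_zero.
Proof.
elim/grot_ind: u => -[x y]; rewrite grot_oppE grot_addE; apply/grot_classP.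
exists (cm_zero M) => /=; congr (cm_add _ _); rewrite cm_addC; congr (cm_add _ _); exact: cm_addC.
Qed.

Definition Grothendieck : agroup :=
  @AGroup (CMonoid grot_addA grot_addC grot_add0) grot_opp grot_addN.

(* The canonical homomorphism from M to its Grothendieck group.                *)
Definition gin (x : M) : Grothendieck := grot_class (x, cm_zero M).

End Grothendieck.

Section GrothendieckMap.
Variables (M N : cmonoid) (f : cmhom M N).

Definition gmap_pair (p : M * M) : N * N := (f p.1, f p.2).

Lemma geq_map p q : geq p q -> geq (gmap_pair p) (gmap_pair q).
Proof. by case=> z h; exists (f z); rewrite /= -!cm_funD h. Qed.

Definition gmap_fun (u : Grothendieck M) : Grothendieck N :=
  grot_class (gmap_pair (qrepr u)).

Lemma gmap_funE p : gmap_fun (grot_class p) = grot_class (gmap_pair p).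
Proof.
apply/grot_classP/geq_map.
exact: (qrepr_class (@geq_refl M) (@geq_sym M) (@geq_trans M)).
Qed.

Lemma gmap_fun0 : gmap_fun (cm_zero _) = cm_zero _.
Proof. by rewrite gmap_funE /gmap_pair /= !cm_fun0. Qed.

Lemma gmap_funD u v : gmap_fun (cm_add u v) = cm_add (gmap_fun u) (gmap_fun v).
Proof.
elim/grot_ind: u => p; elim/grot_ind: v => q.
by rewrite /= grot_addE !gmap_funE grot_addE /gmap_pair /pair_add /= !cm_funD.
Qed.

Definition gmap : cmhom (Grothendieck M) (Grothendieck N) :=
  CMHom gmap_fun0 gmap_funD.

Lemma gmap_in x : gmap (gin x) = gin (f x).
Proof. by rewrite /= gmap_funE /gmap_pair /= cm_fun0. Qed.

End GrothendieckMap.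

(* Right S-semimodules are left semimodules over the converse semiring S^c:    *)
(* the right action of a : S on v is (a : S^c) *: v.                           *)
Notation rsemimod S := (lSemiModType (S^c)%type).

(* S^n, on which S acts by componentwise right multiplication (rfreeE).        *)
Definition rfree (S : pzSemiRingType) (n : nat) : rsemimod S := 'rV[S^c]_n.

Lemma rfreeE (S : pzSemiRingType) n (a : S) (v : 'rV[S]_n) (i : 'I_n) :
  ((a : S^c) *: (v : rfree S n) : 'rV[S]_n) 0 i = v 0 i * a.
Proof. by rewrite mxE. Qed.

Definition dsum (R : pzSemiRingType) (P Q : lSemiModType R) : lSemiModType R :=
  (P * Q)%type.

Section Isomorphism.
Variable R : pzSemiRingType.
Implicit Types P Q : lSemiModType R.

Definition isom P Q : Prop := exists f : {linear P -> Q}, bijective f.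

Definition mklinear P Q (f : P -> Q) (lf : semilinear f) : {linear P -> Q} :=
  HB.pack f (GRing.isSemilinear.Build R P Q *:%R f lf).

Lemma isomI P Q (f : P -> Q) : semilinear f -> bijective f -> isom P Q.
Proof. by move=> lf bf; exists (mklinear lf). Qed.

Lemma isom_refl P : isom P P.
Proof. by apply: (@isomI _ _ id) => //; exists id. Qed.

Lemma isom_linear P Q : isom P Q ->
  exists (f : {linear P -> Q}) (g : {linear Q -> P}), cancel f g /\ cancel g f.
Proof.
case=> f [g fK gK]; have lg : semilinear g.
  split=> [a u|u v]; apply: (can_inj fK); first by rewrite linearZ /= !gK.
  by rewrite raddfD /= !gK.
by exists f, (mklinear lg).
Qed.

Lemma isom_sym P Q : isom P Q -> isom Q P.
Proof.
by move=> /isom_linear[f [g [fK gK]]]; exists g; exists f.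
Qed.

Lemma isom_trans P Q T : isom P Q -> isom Q T -> isom P T.
Proof.
case=> f bf [g bg]; apply: (@isomI _ _ (g \o f)); last exact: bij_comp.
by split=> [a u|u v]; rewrite /= ?linearZ //= ?raddfD.
Qed.

Lemma isom_dsum P P' Q Q' :
  isom P P' -> isom Q Q' -> isom (dsum P Q) (dsum P' Q').
Proof.
case=> f [f' fK f'K] [g [g' gK g'K]].
apply: (@isomI (dsum P Q) (dsum P' Q') (fun u => (f u.1, g u.2))).
  by split=> [a u|u v]; rewrite /= ?linearZ //= ?raddfD.
by exists (fun u => (f' u.1, g' u.2)) => -[x y] /=; rewrite ?fK ?f'K ?gK ?g'K.
Qed.

Lemma isom_dsumA P Q T : isom (dsum P (dsum Q T)) (dsum (dsum P Q) T).
Proof.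
apply: (@isomI (dsum P (dsum Q T)) (dsum (dsum P Q) T)
               (fun u => ((u.1, u.2.1), u.2.2))).
  by split.
by exists (fun u => (u.1.1, (u.1.2, u.2))) => [[x [y z]]|[[x y] z]].
Qed.

Lemma isom_dsumC P Q : isom (dsum P Q) (dsum Q P).
Proof.
apply: (@isomI (dsum P Q) (dsum Q P) (fun u => (u.2, u.1))).
  by split.
by exists (fun u => (u.2, u.1)) => -[x y].
Qed.

Lemma isom_dsum0 (Z P : lSemiModType R) :
  (forall z : Z, z = 0) -> isom (dsum Z P) P.
Proof.
move=> Z0; apply: (@isomI (dsum Z P) P (fun u => u.2)).
  by split.
by exists (fun x => (0, x)) => [[z x]|x] //=; rewrite (Z0 z).
Qed.

End Isomorphism.

Section Projective.
Variable S : pzSemiRingType.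
Implicit Types P Q : rsemimod S.

Definition fgproj P : Prop :=
  exists (n : nat) (f : {linear rfree S n -> P}) (g : {linear P -> rfree S n}),
    cancel g f.

(* S^n = A (+) B for some A isomorphic to P.                                   *)
Definition fgsproj P : Prop :=
  exists (n : nat) (Q : rsemimod S), isom (dsum P Q) (rfree S n).

Lemma isom_dsumACA (P Q P' Q' : rsemimod S) :
  isom (dsum (dsum P Q) (dsum P' Q')) (dsum (dsum P P') (dsum Q Q')).
Proof.
apply: (@isomI _ (dsum (dsum P Q) (dsum P' Q')) (dsum (dsum P P') (dsum Q Q'))
  (fun u => ((u.1.1, u.2.1), (u.1.2, u.2.2)))).
  by split.
by exists (fun u => ((u.1.1, u.2.1), (u.1.2, u.2.2))) => -[[? ?] [? ?]].
Qed.

Lemma rfree0 (v : rfree S 0) : v = 0.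
Proof. by apply/matrixP=> i []. Qed.

Lemma rfreeD m n : isom (dsum (rfree S m) (rfree S n)) (rfree S (m + n)).
Proof.
apply: (@isomI _ (dsum (rfree S m) (rfree S n)) (rfree S (m + n))
  (fun u => row_mx (u.1 : 'rV_m) (u.2 : 'rV_n))).
  split=> [a u|u v].
    exact/esym/(@scale_row_mx S^c 1 m n).
  exact/esym/(@add_row_mx S^c 1 m n).
exists (fun v => (lsubmx (v : 'rV_(m + n)), rsubmx (v : 'rV_(m + n)))) => [[x y]|v].
  by rewrite row_mxKl row_mxKr.
exact: hsubmxK.
Qed.

Lemma fgproj_rfree n : fgproj (rfree S n).
Proof. by exists n, idfun, idfun. Qed.

Lemma fgsproj_rfree n : fgsproj (rfree S n).
Proof.
exists n, (rfree S 0); apply: isom_trans (isom_dsumC _ _) _.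
exact/isom_dsum0/rfree0.
Qed.

Lemma fgproj_dsum P Q : fgproj P -> fgproj Q -> fgproj (dsum P Q).
Proof.
case=> m [f [g gK]] [n [f' [g' g'K]]].
have [h [k [hK kK]]] := isom_linear (rfreeD m n).
pose F (u : dsum (rfree S m) (rfree S n)) : dsum P Q := (f u.1, f' u.2).
pose G (u : dsum P Q) : dsum (rfree S m) (rfree S n) := (g u.1, g' u.2).
have lF : semilinear F by split=> [a u|u v]; rewrite /F /= ?linearZ //= ?raddfD.
have lG : semilinear G by split=> [a u|u v]; rewrite /G /= ?linearZ //= ?raddfD.
exists (m + n)%N, (mklinear lF \o k), (h \o mklinear lG) => -[x y] /=.
by rewrite hK /F /G /= gK g'K.
Qed.

Lemma fgsproj_dsum P Q : fgsproj P -> fgsproj Q -> fgsproj (dsum P Q).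
Proof.
case=> m [P' hP] [n [Q' hQ]]; exists (m + n)%N, (dsum P' Q').
apply: isom_trans (isom_dsumACA _ _ _ _) _.
exact: isom_trans (isom_dsum hP hQ) (rfreeD m n).
Qed.

Lemma fgsproj_proj P : fgsproj P -> fgproj P.
Proof.
case=> n [Q /isom_linear[h [k [hK kK]]]].
pose F (u : dsum P Q) : P := u.1.
pose G (x : P) : dsum P Q := (x, 0).
have lF : semilinear F by [].
have lG : semilinear G.
  by split=> [a u|u v]; congr (_, _); rewrite ?scaler0 ?addr0.
by exists n, (mklinear lF \o k), (h \o mklinear lG) => x /=; rewrite hK.
Qed.

End Projective.

(* The monoid of isomorphism classes of the semimodules in a class C that      *)
(* contains 0 and is closed under direct sums.                                 *)
Section IsoClasses.
Variables (S : pzSemiRingType) (C : rsemimod S -> Prop).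
Hypothesis C0 : C (rfree S 0).
Hypothesis CD : forall P Q, C P -> C Q -> C (dsum P Q).

Definition cobj : Type := {P : rsemimod S | C P}.
Definition cisom (P Q : cobj) : Prop := isom (sval P) (sval Q).
Definition cdsum (P Q : cobj) : cobj :=
  exist C (dsum (sval P) (sval Q)) (CD (svalP P) (svalP Q)).

Definition icls_type := quot cisom.
Definition icls_class : cobj -> icls_type := @qclass _ cisom.

Lemma cisom_refl P : cisom P P. Proof. exact: isom_refl. Qed.
Lemma cisom_sym P Q : cisom P Q -> cisom Q P. Proof. exact: isom_sym. Qed.
Lemma cisom_trans P Q T : cisom P Q -> cisom Q T -> cisom P T.
Proof. exact: isom_trans. Qed.

Lemma icls_classP P Q : icls_class P = icls_class Q <-> isom (sval P) (sval Q).
Proof. exact: (qclassP cisom_refl cisom_sym cisom_trans). Qed.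

Definition icls_zero : icls_type := icls_class (exist C (rfree S 0) C0).
Definition icls_add (x y : icls_type) : icls_type :=
  icls_class (cdsum (qrepr x) (qrepr y)).

Lemma icls_ind (T : icls_type -> Prop) :
  (forall P, T (icls_class P)) -> forall x, T x.
Proof. by move=> h x; rewrite -(qreprK x); apply: h. Qed.

Lemma icls_addE P Q :
  icls_add (icls_class P) (icls_class Q) = icls_class (cdsum P Q).
Proof.
apply/icls_classP/isom_dsum;
  exact: (qrepr_class cisom_refl cisom_sym cisom_trans).
Qed.

Lemma icls_addA x y z : icls_add x (icls_add y z) = icls_add (icls_add x y) z.
Proof.
elim/icls_ind: x => P; elim/icls_ind: y => Q; elim/icls_ind: z => T.
rewrite !icls_addE; apply/icls_classP; exact: isom_dsumA.
Qed.

Lemma icls_addC x y : icls_add x y = icls_add y x.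
Proof.
elim/icls_ind: x => P; elim/icls_ind: y => Q.
rewrite !icls_addE; apply/icls_classP; exact: isom_dsumC.
Qed.

Lemma icls_add0 x : icls_add icls_zero x = x.
Proof.
elim/icls_ind: x => P; rewrite icls_addE; apply/icls_classP.
exact/isom_dsum0/rfree0.
Qed.

Definition icls : cmonoid := CMonoid icls_addA icls_addC icls_add0.

End IsoClasses.

Section K0.
Variable S : pzSemiRingType.

Definition VV : cmonoid := icls (fgproj_rfree S 0) (@fgproj_dsum S).
Definition SV : cmonoid := icls (fgsproj_rfree S 0) (@fgsproj_dsum S).

Definition Vclass (P : rsemimod S) (hP : fgproj P) : VV :=
  icls_class (exist (@fgproj S) P hP).
Definition SVclass (P : rsemimod S) (hP : fgsproj P) : SV :=
  icls_class (exist (@fgsproj S) P hP).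

Definition K0 : agroup := Grothendieck VV.
Definition SK0 : agroup := Grothendieck SV.

Definition K0class (P : rsemimod S) (hP : fgproj P) : K0 := gin (Vclass hP).
Definition SK0class (P : rsemimod S) (hP : fgsproj P) : SK0 := gin (SVclass hP).

(* The inclusion of SV(S) into V(S), sending the class of P to that of P.      *)
Definition sproj_proj (P : cobj (@fgsproj S)) : cobj (@fgproj S) :=
  exist (@fgproj S) (sval P) (fgsproj_proj (svalP P)).

Definition SV_V_fun (x : SV) : VV := icls_class (sproj_proj (qrepr x)).

Lemma SV_V_funE (P : cobj (@fgsproj S)) :
  SV_V_fun (icls_class P) = icls_class (sproj_proj P).
Proof.
apply/icls_classP; rewrite /=.
exact: (qrepr_class (@cisom_refl _ _) (@cisom_sym _ _) (@cisom_trans _ _)).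
Qed.

Lemma SV_V_fun0 : SV_V_fun (cm_zero SV) = cm_zero VV.
Proof. by rewrite SV_V_funE; apply/icls_classP; apply: isom_refl. Qed.

Lemma SV_V_funD x y :
  SV_V_fun (cm_add x y) = cm_add (SV_V_fun x) (SV_V_fun y).
Proof.
elim/icls_ind: x => P; elim/icls_ind: y => Q.
rewrite /= icls_addE !SV_V_funE icls_addE; apply/icls_classP.
exact: isom_refl.
Qed.

Definition SV_V : cmhom SV VV := CMHom SV_V_fun0 SV_V_funD.

Definition jmath : cmhom SK0 K0 := gmap SV_V.

Lemma jmathE (P : rsemimod S) (hP : fgsproj P) (hP' : fgproj P) :
  jmath (SK0class hP) = K0class hP'.
Proof.
rewrite /jmath gmap_in; congr gin; rewrite /= /SVclass SV_V_funE.
by apply/icls_classP; apply: isom_refl.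
Qed.

End K0.

(* S \ {0} is a group under multiplication with identity 1.                    *)
Definition division_semiring (S : pzSemiRingType) : Prop :=
  [/\ (1 : S) <> 0,
      forall x y : S, x <> 0 -> y <> 0 -> x * y <> 0 &
      forall x : S, x <> 0 -> exists y : S, [/\ y <> 0, x * y = 1 & y * x = 1]].

Definition weakly_cancellative (S : pzSemiRingType) : Prop :=
  forall a b : S, a + a = a + b -> a = b.

(* Main.v *)
(* If D is zerosumfree, i.e. not a division ring, generators of M (+) N split  *)
(* into generators of M and generators of N, so minimal numbers of generators *)
(* add up; over a division ring one eliminates instead. Hence D^m (+) Z and   *)
(* D^n (+) Z are isomorphic only for m = n, and strongly projective           *)
(* semimodules are free: this is the injectivity. If D is weakly cancellative *)
(* then so is every projective P, and an absorption argument on a minimal     *)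
(* dual frame shows that P is free. Otherwise 1 + 1 = 1 + c with c <> 1; with *)
(* h = (1 + 1)^-1 the matrix h [[1, c], [1, 1]] is idempotent. Its row space  *)
(* P needs two generators u, v, but u + v = v + v, so P has at most 3 < 2^2   *)
(* homomorphisms to the Boolean semifield. As the number of these is          *)
(* multiplicative, [P] is not a difference of classes of free semimodules.    *)

From HB Require Import structures.
From mathcomp Require Import all_boot all_algebra.
From mathcomp Require Import boolp.
Require Import Defs.

Set Implicit Arguments.
Unset Strict Implicit.
Unset Printing Implicit Defensive.

Import GRing.Theory.
Local Open Scope ring_scope.

(** Equality in a Grothendieck group is equality after adding a common class [Z], so injectivity of
    [jmath] means that strongly projective semimodules that become isomorphic after adding a
    projective [Z] are already isomorphic. By [ring_or_zerosumfree] the semiring is a division ring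
    or zerosumfree. In both cases strongly projective semimodules are free, by [fgproj_free] and
    [summand_free] respectively, and [row_cancel] recovers the rank in the presence of [Z].

    If [D] is weakly cancellative, [fgproj_free] makes every finitely generated projective free, so
    [SV_V] is onto and hence so is [jmath]. The key is [min_frame_orth]: the generators of a minimal
    dual frame have Kronecker coordinates.

    For the converse, two invariants are compared in the zerosumfree case: the minimal number of
    generators, additive by [mingen_dsum], and the number of Boolean functionals, multiplicative by
    [nbool_hom_dsum]. A free semimodule of rank [n] has values [n] and [2 ^ n], and this link
    extends to differences of free classes; the semimodule of [nonfree_proj] has values 2 and at
    most 3, which violates it. Right semimodules over [D] are handled as left ones over [D^c], again
    a division semiring. *)

Definition zerosumfree (M : nmodType) : Prop :=
  forall x y : M, x + y = 0 -> x = 0.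

Definition wcancel (M : nmodType) : Prop :=
  forall x y : M, x + x = x + y -> x = y.

Lemma zerosumfree_sum (M : nmodType) (I : finType) (A : pred I) (F : I -> M) :
  zerosumfree M -> \sum_(i | A i) F i = 0 -> forall i, A i -> F i = 0.
Proof. by move=> zM h i Ai; move: h; rewrite (bigD1 i) //= => /zM. Qed.

(** Put [w = u + v = x + s]. Since [w] contains [x], it satisfies [w + u = w + v], hence
    [w + w = w + (u + u)]. Weak cancellation gives [u + v = u + u], and a second use gives
    [u = v]. *)
Lemma wcancel_absorb (M : nmodType) (x s u v : M) :
  wcancel M -> x + u = x + v -> x + s = u + v -> u = v.
Proof.
move=> wM e1 e2.
have [w wE] : exists w, w = u + v by exists (u + v).
have e3 : w + u = w + v by rewrite wE -e2 addrAC e1 addrAC.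
have e4 : w + w = w + (u + u) by rewrite {2}wE addrA addrAC -e3 addrA.
by have := wM _ _ e4; rewrite wE => /esym/wM.
Qed.

(** * Fixed points of an endomorphism, used to realise the image of an idempotent matrix *)

Section FixedPoints.
Variables (R : pzSemiRingType) (M : lSemiModType R) (e : {linear M -> M}).

Definition fixed_pred : {pred M} := [pred x | e x == x].

Lemma fixed_subsemimod : subsemimod_closed fixed_pred.
Proof.
split=> [|a x]; last by rewrite !inE => /eqP ex; rewrite linearZ /= ex.
split; first by rewrite inE raddf0.
by move=> x y; rewrite !inE => /eqP ex /eqP ey; rewrite raddfD /= ex ey.
Qed.

HB.instance Definition _ := GRing.isSubSemiModClosed.Build R M fixed_pred fixed_subsemimod.

Record fixed := Fixed { fixed_val : M; fixed_valP : fixed_val \in fixed_pred }.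
HB.instance Definition _ := [isSub for fixed_val].
HB.instance Definition _ := [Choice of fixed by <:].
HB.instance Definition _ := [SubChoice_isSubLSemiModule of fixed by <:].

End FixedPoints.

(** * Left semimodules over a division semiring *)

Section DivisionSemiring.
Variable R : pzSemiRingType.
Hypothesis hR : division_semiring R.
Implicit Types (a b c : R) (M N P : lSemiModType R).

Lemma div_oner_neq0 : (1 : R) <> 0. Proof. by case: hR. Qed.

Lemma div_inv a : a <> 0 -> exists b, [/\ b <> 0, a * b = 1 & b * a = 1].
Proof. by case: hR => _ _; apply. Qed.

Lemma div_mulf_eq0 a b : a * b = 0 -> a = 0 \/ b = 0.
Proof.
move=> h; case: (pselect (a = 0)) => [|a0]; first by left.
case: (pselect (b = 0)) => [|b0]; first by right.
by case: hR => _ /(_ a b a0 b0).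
Qed.

Lemma div_scaleI M a (x y : M) : a <> 0 -> a *: x = a *: y -> x = y.
Proof.
case/div_inv=> b [_ _ ba] e.
by rewrite -[x]scale1r -[y]scale1r -ba -!scalerA e.
Qed.

Lemma div_scale_eq0 M a (x : M) : a *: x = 0 -> a = 0 \/ x = 0.
Proof.
case: (pselect (a = 0)) => [->|a0 h]; first by left.
by right; apply: (div_scaleI a0); rewrite h scaler0.
Qed.

(** Dividing a relation [a + b = 0] by a nonzero [a] produces an additive inverse of 1. *)
Lemma ring_or_zerosumfree : (exists m : R, 1 + m = 0) \/ zerosumfree R.
Proof.
case: (pselect (exists m : R, 1 + m = 0)) => [|h]; [by left | right] => a b e.
case: (pselect (a = 0)) => // /div_inv[c [_ _ ca]]; case: h; exists (c * b).
by rewrite -ca -mulrDr e mulr0.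
Qed.

Lemma wcancel_ring : (exists m : R, 1 + m = 0) -> wcancel R.
Proof.
case=> m hm x y /(congr1 (+%R (m * x))).
have mx : m * x + x = 0 by rewrite -{2}[x]mul1r -mulrDl addrC hm mul0r.
by rewrite !addrA mx !add0r.
Qed.

Lemma zerosumfree_row n : zerosumfree R -> zerosumfree 'rV[R]_n.
Proof.
move=> zR x y /rowP e; apply/rowP=> i; rewrite mxE.
by apply: (zR _ (y 0 i)); have := e i; rewrite !mxE.
Qed.

Lemma wcancel_row n : wcancel R -> wcancel 'rV[R]_n.
Proof.
move=> wR x y /rowP e; apply/rowP=> i; apply: wR.
by have := e i; rewrite !mxE.
Qed.

Section Inj.
Variables (M N : lSemiModType R) (f : {linear M -> N}).
Hypothesis fI : injective f.

Lemma zerosumfree_inj : zerosumfree N -> zerosumfree M.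
Proof.
move=> zN x y e; apply: fI; rewrite raddf0; apply: (zN _ (f y)).
by rewrite -raddfD e raddf0.
Qed.

Lemma wcancel_inj : wcancel N -> wcancel M.
Proof. by move=> wN x y e; apply/fI/wN; rewrite -!raddfD e. Qed.
End Inj.

(** * Dual frames and freeness *)

Definition spanned M n (p : 'I_n -> M) (A : {set 'I_n}) (x : M) : Prop :=
  exists a : 'I_n -> R, x = \sum_(i in A) a i *: p i.

Lemma spannedZ M n (p : 'I_n -> M) (A : {set 'I_n}) a x :
  spanned p A x -> spanned p A (a *: x).
Proof.
case=> b ->; exists (fun i => a * b i); rewrite scaler_sumr.
by apply: eq_bigr => i _; rewrite scalerA.
Qed.

Lemma spanned_inv M n (p : 'I_n -> M) (A : {set 'I_n}) a x :
  a <> 0 -> spanned p A (a *: x) -> spanned p A x.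
Proof.
by case/div_inv=> b [_ _ ba] /(spannedZ b); rewrite scalerA ba scale1r.
Qed.

(** This is the dual basis criterion for projectivity. The subset [A] lets generators be discarded
    without reindexing; coordinates outside [A] are ignored. *)
Definition dual_frame P n (p : 'I_n -> P) (A : {set 'I_n})
    (g : {linear P -> 'rV[R]_n}) : Prop :=
  forall x, x = \sum_(i in A) g x 0 i *: p i.

Lemma dual_frame_inj P n (p : 'I_n -> P) A g : dual_frame p A g -> injective g.
Proof. by move=> h x y e; rewrite [x]h [y]h e. Qed.

Lemma dual_frame_retract P n (f : {linear 'rV[R]_n -> P}) (g : {linear P -> 'rV[R]_n}) :
  cancel g f -> dual_frame (fun i => f (delta_mx 0 i)) setT g.
Proof.
move=> gK x; rewrite -{1}[x]gK {1}[g x]row_sum_delta raddf_sum.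
by apply: eq_big => [i|i _]; rewrite ?inE //= linearZ.
Qed.

Lemma dual_frame_free P n (p : 'I_n -> P) (A : {set 'I_n}) g :
  dual_frame p A g ->
  {in A &, forall i k, g (p i) 0 k = (i == k)%:R} ->
  isom P 'rV[R]_#|A|.
Proof.
move=> hg gp; pose f x : 'rV[R]_#|A| := \row_k g x 0 (enum_val k).
apply: (@isomI _ _ _ f).
  by split=> [a u|u v]; apply/rowP=> k; rewrite !mxE ?linearZ ?raddfD mxE.
pose h (v : 'rV[R]_#|A|) := \sum_k v 0 k *: p (enum_val k).
exists h => [x|v].
  rewrite {2}[x]hg [RHS](big_enum_val (fun i => g x 0 i *: p i)) /=.
  by apply: eq_bigr => k _; rewrite mxE.
apply/rowP=> k; rewrite mxE raddf_sum summxE (bigD1 k) //= big1 => [|i ik].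
  by rewrite linearZ mxE gp ?enum_valP // eqxx mulr1 addr0.
rewrite linearZ mxE gp ?enum_valP // (inj_eq enum_val_inj) (negbTE ik).
by rewrite mulr0.
Qed.

(** If [p j] is the combination of the others with coefficients [a i], the [j]-th coordinate is
    redistributed: the new [i]-th coordinate is [g_i + g_j a_i], still linear. *)
Lemma dual_frame_drop P n (p : 'I_n -> P) (A : {set 'I_n}) g j :
  dual_frame p A g -> j \in A -> spanned p (A :\ j) (p j) ->
  exists g', dual_frame p (A :\ j) g'.
Proof.
move=> hg jA [a ha].
pose G x : 'rV[R]_n := \row_i (g x 0 i + g x 0 j * a i).
have lG : semilinear G.
  split=> [b u|u v]; apply/rowP=> k; rewrite !mxE ?linearZ ?raddfD !mxE.
    by rewrite mulrDr mulrA.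
  by rewrite mulrDl addrACA.
exists (mklinear lG) => x; rewrite [LHS]hg (big_setD1 j) //= {1}ha.
rewrite scaler_sumr -big_split /=; apply: eq_bigr => i _.
by rewrite mxE scalerDl scalerA addrC.
Qed.

Lemma dual_frame_min P n (p : 'I_n -> P) A0 g0 : dual_frame p A0 g0 ->
  exists A g, dual_frame p A g /\
    forall j, j \in A -> ~ spanned p (A :\ j) (p j).
Proof.
move=> h0; pose Q A := `[< exists g, dual_frame p A g >].
have [A /minsetP[/asboolP[g hg] minA] _] : {A | minset Q A & A \subset A0}.
  by apply: minset_exists; apply/asboolP; exists g0.
exists A, g; split=> // j jA /(dual_frame_drop hg jA)/asboolP/minA e.
by have := setD11 j A; rewrite e ?subsetDl // jA.
Qed.

(* The coordinate a of p j satisfies a + t = 1, and absorption gives r = t p j *)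
(* for the part r of p j carried by the other generators; minimality kills t.  *)
Lemma min_frame_orth P n (p : 'I_n -> P) (A : {set 'I_n}) g j :
  wcancel P -> dual_frame p A g -> j \in A -> ~ spanned p (A :\ j) (p j) ->
  g (p j) 0 j = 1 /\ \sum_(i in A :\ j) g (p j) 0 i *: p i = 0.
Proof.
move=> wP hg jA nsp.
pose phi x := g x 0 j; pose rho x := \sum_(i in A :\ j) g x 0 i *: p i.
have split_x x : x = phi x *: p j + rho x by rewrite [LHS]hg (big_setD1 j).
have phiD x y : phi (x + y) = phi x + phi y by rewrite /phi raddfD mxE.
have phiZ a x : phi (a *: x) = a * phi x by rewrite /phi linearZ mxE.
have rhoD x y : rho (x + y) = rho x + rho y.
  rewrite /rho -big_split; apply: eq_bigr => i _.
  by rewrite raddfD mxE scalerDl.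
have rhoZ a x : rho (a *: x) = a *: rho x.
  rewrite /rho scaler_sumr; apply: eq_bigr => i _.
  by rewrite linearZ mxE scalerA.
have rho_sp x : spanned p (A :\ j) (rho x) by exists (g x 0).
set a := phi (p j); set r := rho (p j).
have pj : p j = a *: p j + r := split_x (p j).
have a0 : a <> 0.
  by move=> a0; apply: nsp; rewrite pj a0 scale0r add0r; exact: rho_sp.
have [b [_ ab ba]] := div_inv a0; pose t := b * phi r.
have qE : phi r = a * t by rewrite /t mulrA ab mul1r.
(* Apply [phi] to [pj] and cancel [a] on the left. *)
have at1 : a + t = 1.
  have: a = a * a + a * t by rewrite -qE -phiZ -phiD -pj.
  by move/(congr1 (fun x => b * x)); rewrite -mulrDr mulrA ba mul1r.
pose y := rho r.
have r1 : r = a *: r + y by rewrite -[a *: r]rhoZ -rhoD -pj.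
have r2 : r = (a * t) *: p j + y by rewrite -qE; exact: split_x.
have tp : t *: p j = (t * a) *: p j + (t * t) *: p j.
  by rewrite -scalerDl -mulrDr at1 mulr1.
have rt : r = t *: p j.
  (* By [at1], [r = a r + t r] and [t p_j = a t p_j + t t p_j]. Since [y + a r = r = y + a t p_j]
     and [t a p_j + t r = t p_j = t a p_j + t t p_j], adding [y + t a p_j] to [r] and to [t p_j]
     gives the same result. The second argument completes [y + t a p_j] to [r + t p_j]. *)
  apply: (@wcancel_absorb _ (y + (t * a) *: p j)
            (a *: r + (t * t) *: p j) _ _ wP).
    have e1 : (t * a) *: p j + t *: r = (t * a) *: p j + (t * t) *: p j.
      by rewrite -tp -scalerA -scalerDr; congr (_ *: _); exact: esym.
    have e2 : y + a *: r = y + (a * t) *: p j by rewrite addrC -r1 addrC -r2.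
    have er : r = a *: r + t *: r by rewrite -scalerDl at1 scale1r.
    have et : t *: p j = (a * t) *: p j + (t * t) *: p j.
      by rewrite -scalerDl -mulrDl at1 mul1r.
    transitivity (y + (t * a) *: p j + (a *: r + t *: r)); first by rewrite -er.
    by rewrite addrACA e1 e2 addrACA -et.
  by rewrite addrACA (addrC y) -r1 -tp.
have t0 : t = 0.
  case: (pselect (t = 0)) => // t0; case: nsp; apply: (spanned_inv t0).
  by rewrite -rt; exact: rho_sp.
by split; [rewrite -at1 t0 addr0 | rewrite -/(rho _) -/r rt t0 scale0r].
Qed.

(** Over a division ring the relation is solved for [p k]; in the zerosumfree case every term
    vanishes, so [p k = 0]. *)
Lemma spanned_of_sum0 P n (p : 'I_n -> P) (A : {set 'I_n}) (a : 'I_n -> R) k :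
  (zerosumfree R -> zerosumfree P) -> k \in A -> a k <> 0 ->
  \sum_(i in A) a i *: p i = 0 -> spanned p (A :\ k) (p k).
Proof.
move=> zP kA ak0 s0; apply: (spanned_inv ak0).
case: ring_or_zerosumfree => [[m hm]|/zP zP'].
  exists (fun i => m * a i); move: s0; rewrite (big_setD1 k) //=.
  set s := \sum_(i in _) _ => s0.
  have -> : \sum_(i in A :\ k) (m * a i) *: p i = m *: s.
    by rewrite scaler_sumr; apply: eq_bigr => i _; rewrite scalerA.
  have sm : s + m *: s = 0 by rewrite -{1}[s]scale1r -scalerDl hm scale0r.
  by rewrite -[LHS]addr0 -sm addrA s0 add0r.
exists (fun=> 0); rewrite (zerosumfree_sum zP' s0 kA).
by rewrite big1 // => i _; rewrite scale0r.
Qed.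

(** In a minimal dual frame, [min_frame_orth] makes the diagonal coordinates 1 and leaves a null
    combination of the other generators. A nonzero off-diagonal coordinate would make some generator
    redundant by [spanned_of_sum0], so the coordinates are Kronecker and the frame is a basis. *)
Lemma fgproj_free P n (f : {linear 'rV[R]_n -> P}) (g : {linear P -> 'rV[R]_n}) :
  wcancel R -> cancel g f -> exists m, isom P 'rV[R]_m.
Proof.
move=> wR gK; have [A [G [hG minA]]] := dual_frame_min (dual_frame_retract gK).
exists #|A|; apply: (dual_frame_free hG) => i k iA kA.
have GI := dual_frame_inj hG.
have [e1 e0] := min_frame_orth (wcancel_inj GI (wcancel_row wR)) hG iA (minA _ iA).
case: eqP => [<- //|ik]; apply: contrapT => nz; apply: (minA k kA).
have kAi : k \in A :\ i by rewrite !inE kA eq_sym; apply/andP; split=> //; apply/eqP.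
have [|b hb] := spanned_of_sum0 _ kAi nz e0.
  by move=> zR; apply: (zerosumfree_inj GI (zerosumfree_row zR)).
(* The combination avoids both [i] and [k]; coefficient 0 at [i] extends it to [A :\ k]. *)
exists (fun l => if l == i then 0 else b l); rewrite hb.
rewrite [RHS](big_setD1 i) /=; last by rewrite !inE iA andbT; apply/eqP.
rewrite eqxx scale0r add0r setDDl setUC -setDDl; apply: eq_bigr => l.
by rewrite !inE; case: (l == i) => //; rewrite ?andbF.
Qed.

(** The basis vector [e i] is the sum of the images of its components [p i] and [q i].
    Zerosumfreeness makes these images multiples [a e_i] and [b e_i] with [a + b = 1]. If both
    scalars were nonzero, [(p i, 0)] would be a multiple of [(0, q i)], forcing [p i = 0] and
    [a = 0]. So [a] is 0 or 1, and the [p i] with [a = 1] form a basis of [P]. *)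
Lemma summand_free P Q n : zerosumfree R ->
  isom (dsum P Q) 'rV[R]_n -> exists m, isom P 'rV[R]_m.
Proof.
move=> zR /isom_linear[h [k [hK kK]]].
pose e i : 'rV[R]_n := delta_mx 0 i.
pose p i : P := (k (e i)).1; pose q i : Q := (k (e i)).2.
pose g x := h ((x, 0) : dsum P Q).
have lg : semilinear g.
  rewrite /g; split=> [a u|u v]; rewrite -?linearZ -?raddfD /=.
    by congr (h (_, _)); rewrite scaler0.
  by congr (h (_, _)); rewrite addr0.
have ehpq i : g (p i) + h ((0, q i) : dsum P Q) = e i.
  rewrite /g -raddfD -[RHS]kK; congr (h _).
  by rewrite [RHS]surjective_pairing; congr (_, _); rewrite ?addr0 ?add0r.
have gp_off i l : l != i -> g (p i) 0 l = 0.
  move=> li; apply: (zR _ (h ((0, q i) : dsum P Q) 0 l)).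
  by have := congr1 (fun v : 'rV[R]_n => v 0 l) (ehpq i); rewrite !mxE (negbTE li) andbF.
have hq_off i l : l != i -> h ((0, q i) : dsum P Q) 0 l = 0.
  move=> li; apply: (zR _ (g (p i) 0 l)).
  by have := congr1 (fun v : 'rV[R]_n => v 0 l) (ehpq i); rewrite !mxE addrC (negbTE li) andbF.
have gpE i : g (p i) = g (p i) 0 i *: e i.
  apply/rowP=> l; rewrite !mxE eqxx /=; case: eqP => [->|/eqP li].
    by rewrite mulr1.
  by rewrite mulr0 gp_off.
have hqE i : h ((0, q i) : dsum P Q) = h ((0, q i) : dsum P Q) 0 i *: e i.
  apply/rowP=> l; rewrite !mxE eqxx /=; case: eqP => [->|/eqP li].
    by rewrite mulr1.
  by rewrite mulr0 hq_off.
have gp1 i : g (p i) 0 i != 0 -> g (p i) 0 i = 1.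
  move=> /eqP a0; set b := h ((0, q i) : dsum P Q) 0 i.
  have ab : g (p i) 0 i + b = 1.
    by have := congr1 (fun v : 'rV[R]_n => v 0 i) (ehpq i); rewrite !mxE !eqxx.
  case: (pselect (b = 0)) => [b0|b0]; first by rewrite -ab b0 addr0.
  case: a0; have [a' [_ _ a'a]] := div_inv b0.
  have : h ((p i, 0) : dsum P Q) = h ((0, (g (p i) 0 i * a') *: q i) : dsum P Q).
    have -> : ((0, (g (p i) 0 i * a') *: q i) : dsum P Q)
            = (g (p i) 0 i * a') *: ((0, q i) : dsum P Q).
      by congr (_, _); rewrite scaler0.
    by rewrite linearZ /= hqE -/b scalerA -mulrA a'a mulr1 -gpE.
  move/(can_inj hK)/(congr1 fst) => /= ->.
  by rewrite /g [X in h X](_ : _ = 0) // raddf0 mxE.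
pose A := [set i | g (p i) 0 i != 0].
have hA : dual_frame p A (mklinear lg).
  move=> x; have {1}-> : x = (k (g x)).1 by rewrite /g hK.
  rewrite [g x in LHS]row_sum_delta raddf_sum.
  rewrite (raddf_sum (fst : {additive (P * Q)%type -> P})).
  rewrite (bigID (mem A)) /= [X in _ + X]big1 ?addr0 => [|i].
    by apply: eq_bigr => i _; rewrite /= linearZ.
  rewrite inE negbK => /eqP gpi0; rewrite linearZ /=.
  suff -> : (k (delta_mx 0 i)).1 = 0 by rewrite scaler0.
  have : g (p i) = g 0 by rewrite gpE gpi0 scale0r /g [X in h X](_ : _ = 0) // raddf0.
  by move/(can_inj hK)/(congr1 fst).
exists #|A|; apply: (dual_frame_free hA) => i l; rewrite !inE => iA _.
by rewrite /= gpE gp1 // scale1r mxE eqxx eq_sym.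
Qed.

(** * Numbers of generators *)

Definition ngen M n : Prop := exists p : 'I_n -> M, forall x, spanned p setT x.

Lemma ngen_set M n (p : 'I_n -> M) (A : {set 'I_n}) :
  (forall x, spanned p A x) -> ngen M #|A|.
Proof.
move=> h; exists (fun k => p (enum_val k)) => x; have [a ->] := h x.
exists (fun k => a (enum_val k)).
rewrite (big_enum_val (fun i => a i *: p i)) /=.
by apply: eq_bigl => k; rewrite inE.
Qed.

Lemma ngen_isom M N n : isom M N -> ngen M n -> ngen N n.
Proof.
move=> /isom_linear[f [g [_ gK]]] [p hp]; exists (fun i => f (p i)) => x.
have [a ha] := hp (g x); exists a; rewrite -[LHS]gK ha raddf_sum.
by apply: eq_bigr => i _; rewrite /= linearZ.
Qed.

Lemma ngen_row n : ngen 'rV[R]_n n.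
Proof.
exists (fun i => delta_mx 0 i) => x; exists (x 0).
by rewrite {1}[x]row_sum_delta; apply: eq_bigl => i; rewrite inE.
Qed.

Lemma ngen_dsum M N m n : ngen M m -> ngen N n -> ngen (dsum M N) (m + n).
Proof.
case=> p hp [q hq].
pose pq (i : 'I_m + 'I_n) : dsum M N :=
  match i with inl j => (p j, 0) | inr j => (0, q j) end.
exists (pq \o @split m n) => -[x y]; have [a ha] := hp x; have [b hb] := hq y.
exists ((fun i => match i with inl j => a j | inr j => b j end) \o @split m n).
rewrite (eq_bigl predT) => [|i]; last by rewrite inE.
rewrite big_split_ord /=.
under eq_bigr => i _ do rewrite (unsplitK (inl i)).
under [X in _ + X]eq_bigr => i _ do rewrite (unsplitK (inr i)).
rewrite [RHS]surjective_pairing; congr (_, _) => /=.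
  rewrite !(raddf_sum (fst : {additive (M * N)%type -> M})) /=.
  rewrite [X in _ + X]big1 => [|i _]; last by rewrite scaler0.
  by rewrite addr0 ha; apply: eq_bigl => i; rewrite inE.
rewrite !(raddf_sum (snd : {additive (M * N)%type -> N})) /=.
rewrite big1 => [|i _]; last by rewrite scaler0.
by rewrite add0r hb; apply: eq_bigl => i; rewrite inE.
Qed.

(** Without cancellation in [M], a generator with nonzero first component cannot occur in an
    expression of [(0, y)], and symmetrically. Hence the generators lying in [N] generate [N], the
    nonzero ones lying in [M] generate [M], and these two sets are disjoint. *)
Lemma ngen_dsum_split M N k : zerosumfree M -> zerosumfree N ->
  ngen (dsum M N) k -> exists m n, [/\ ngen M m, ngen N n & (m + n <= k)%N].
Proof.
move=> zM zN [p hp].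
pose A := [set i | ((p i).2 == 0) && ((p i).1 != 0)].
pose B := [set i | (p i).1 == 0].
exists #|A|, #|B|; split; last first.
- have AB0 : A :&: B = set0.
    by apply/setP=> i; rewrite !inE; case: (_.1 == _); rewrite ?andbF.
  by rewrite -cardsUI AB0 cards0 addn0 -[leqRHS]card_ord max_card.
- apply: (ngen_set (p := fun i => (p i).2)) => y; have [a] := hp (0, y).
  rewrite (eq_bigl predT) => [e|i]; last by rewrite inE.
  have := congr1 fst e; rewrite (raddf_sum (fst : {additive (M * N)%type -> M})).
  move/esym/(zerosumfree_sum zM) => e1.
  have := congr1 snd e; rewrite (raddf_sum (snd : {additive (M * N)%type -> N})) /=.
  move=> e2; exists a; rewrite e2 [RHS]big_mkcond; apply: eq_bigr => i _.
  rewrite inE; case: eqP => // p1.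
  by case: (div_scale_eq0 (e1 i isT)) => [->|//]; rewrite scale0r.
- apply: (ngen_set (p := fun i => (p i).1)) => x; have [a] := hp (x, 0).
  rewrite (eq_bigl predT) => [e|i]; last by rewrite inE.
  have := congr1 snd e; rewrite (raddf_sum (snd : {additive (M * N)%type -> N})).
  move/esym/(zerosumfree_sum zN) => e1.
  have := congr1 fst e; rewrite (raddf_sum (fst : {additive (M * N)%type -> M})) /=.
  move=> e2; exists a; rewrite e2 [RHS]big_mkcond; apply: eq_bigr => i _.
  rewrite inE; case: eqP => [_|p2] /=; last first.
    by case: (div_scale_eq0 (e1 i isT)) => [->|//]; rewrite scale0r.
  by case: eqP => // ->; rewrite scaler0.
Qed.

(** Gaussian elimination: with [b j] invertible, clearing the first coordinates by means of
    generator [j] leaves [k - 1] elements that generate [N]. *)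
Lemma ngen_dsum_row1 N k : (exists m : R, 1 + m = 0) ->
  ngen (dsum 'rV[R]_1 N) k -> exists2 l, k = l.+1 & ngen N l.
Proof.
case=> m hm [p hp]; pose b i := (p i).1 0 0; pose q i := (p i).2.
have hpE (u : dsum 'rV[R]_1 N) : exists a : 'I_k -> R, u.1 0 0 = \sum_i a i * b i /\ u.2 = \sum_i a i *: q i.
  have [a] := hp u; rewrite (eq_bigl predT) => [e|i]; last by rewrite inE.
  exists a; rewrite {1 2}e (raddf_sum (fst : {additive ('rV[R]_1 * N)%type -> 'rV[R]_1})).
  rewrite (raddf_sum (snd : {additive ('rV[R]_1 * N)%type -> N})) summxE; split=> //.
  by apply: eq_bigr => i _; rewrite mxE.
have [j bj0] : exists j, b j <> 0.
  apply: contrapT => nb; apply: div_oner_neq0.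
  have [a [+ _]] := hpE (const_mx 1, 0); rewrite /= mxE big1 // => i _.
  have -> : b i = 0 by apply: contrapT => bi; apply: nb; exists i.
  by rewrite mulr0.
have [c [_ bc _]] := div_inv bj0.
have Ck : #|[set~ j]| = k.-1 by rewrite cardsC1 card_ord.
have k0 : (0 < k)%N := leq_ltn_trans (leq0n j) (ltn_ord j).
exists k.-1; rewrite ?prednK // -Ck.
apply: (ngen_set (p := fun i => q i + (m * (b i * c)) *: q j)) => y.
have [a [/= e1 e2]] := hpE (0, y); exists a; rewrite e2.
(* The scalar [m] is -1, hence central. *)
have mm x : m * x = x * m.
  have h1 : x + m * x = 0 by rewrite -{1}[x]mul1r -mulrDl hm mul0r.
  have h2 : x * m + x = 0 by rewrite -{2}[x]mulr1 -mulrDr addrC hm mulr0.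
  by rewrite -[LHS]add0r -h2 -addrA h1 addr0.
have aj : a j = \sum_(i in [set~ j]) a i * (m * (b i * c)).
  have e3 : a j + (\sum_(i in [set~ j]) a i * b i) * c = 0.
    transitivity ((\sum_i a i * b i) * c); last by rewrite -e1 mxE mul0r.
    rewrite [in RHS](bigD1 j) //= mulrDl -mulrA bc mulr1; congr (_ + _ * _).
    by apply: eq_bigl => i; rewrite !inE.
  have e4 : m * (\sum_(i in [set~ j]) a i * b i) * c
          = \sum_(i in [set~ j]) a i * (m * (b i * c)).
    rewrite mulr_sumr mulr_suml; apply: eq_bigr => i _.
    by rewrite mulrA mm !mulrA.
  rewrite -e4; set s := \sum_(i in _) _ in e3 *.
  have e5 : s * c + m * s * c = 0 by rewrite -mulrA -{1}[s * c]mul1r -mulrDl hm mul0r.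
  by rewrite -[LHS]addr0 -e5 addrA e3 add0r.
rewrite (bigD1 j) //= {1}aj scaler_suml addrC.
rewrite (eq_bigl (mem [set~ j])) => [|i]; last by rewrite !inE.
rewrite -big_split /=; apply: eq_bigr => i _.
by rewrite scalerDr scalerA.
Qed.

Lemma isom_rowD m n : isom (dsum 'rV[R]_m 'rV[R]_n) 'rV[R]_(m + n).
Proof.
pose f (u : dsum 'rV[R]_m 'rV[R]_n) : 'rV[R]_(m + n) := row_mx u.1 u.2.
apply: (@isomI _ _ _ f).
  by split=> [a u|u v]; rewrite /f /= ?scale_row_mx ?add_row_mx.
pose g (v : 'rV[R]_(m + n)) : dsum 'rV[R]_m 'rV[R]_n := (lsubmx v, rsubmx v).
exists g => [[x y]|v]; last exact: hsubmxK.
by rewrite /g /f /= row_mxKl row_mxKr.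
Qed.

Lemma ngen_rowS_neq0 n : ~ ngen 'rV[R]_n.+1 0.
Proof.
case=> p hp; apply: div_oner_neq0; have [a] := hp (const_mx 1).
rewrite big1 => [/rowP/(_ ord0)|[]//]; by rewrite !mxE.
Qed.

(** Peel off one coordinate at a time: elimination over a division ring, or splitting of the
    generators in the zerosumfree case, costs at least one generator. *)
Lemma ngen_row_leq n k : ngen 'rV[R]_n k -> (n <= k)%N.
Proof.
elim: n k => // n IH k /(ngen_isom (isom_sym (isom_rowD 1 n))) h.
case: ring_or_zerosumfree => [hm|zR].
  by have [l -> /IH] := ngen_dsum_row1 hm h.
have [i [j [h1 /IH nj /(leq_trans _)]]] :=
  ngen_dsum_split (zerosumfree_row zR) (zerosumfree_row zR) h; apply.
by case: i h1 => [/ngen_rowS_neq0//|i _]; rewrite addSn ltnS (leq_trans nj) // leq_addl.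
Qed.

Definition mingen M n : Prop := ngen M n /\ forall k, ngen M k -> (n <= k)%N.

Lemma mingen_exists M n : ngen M n -> exists m, mingen M m.
Proof.
move=> h; have ex : exists m, `[< ngen M m >] by exists n; apply/asboolP.
case: (ex_minnP ex) => m /asboolP hm minm; exists m; split=> // k hk.
exact/minm/asboolP.
Qed.

Lemma mingen_uniq M m n : mingen M m -> mingen M n -> m = n.
Proof.
by move=> [h1 m1] [h2 m2]; apply/eqP; rewrite eqn_leq m1 ?m2.
Qed.

Lemma mingen_isom M N n : isom M N -> mingen M n -> mingen N n.
Proof.
move=> i [h m]; split; first exact: ngen_isom h.
by move=> k /(ngen_isom (isom_sym i))/m.
Qed.

Lemma mingen_row n : mingen 'rV[R]_n n.
Proof. by split; [exact: ngen_row | move=> k; exact: ngen_row_leq]. Qed.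

Lemma mingen_dsum M N m n : zerosumfree M -> zerosumfree N ->
  mingen M m -> mingen N n -> mingen (dsum M N) (m + n).
Proof.
move=> zM zN [h1 m1] [h2 m2]; split; first exact: ngen_dsum.
move=> k /(ngen_dsum_split zM zN)[i [j [/m1 mi /m2 nj]]].
exact/leq_trans/leq_add.
Qed.

Lemma zerosumfree_dsum M N : zerosumfree M -> zerosumfree N -> zerosumfree (dsum M N).
Proof.
by move=> zM zN [x y] [x' y'] [/zM-> /zN->].
Qed.

Definition retract_row P n : Prop :=
  exists (f : {linear 'rV[R]_n -> P}) (g : {linear P -> 'rV[R]_n}), cancel g f.

Lemma retract_ngen P n : retract_row P n -> ngen P n.
Proof.
case=> f [g /dual_frame_retract h]; exists (fun i => f (delta_mx 0 i)) => x.
by exists (g x 0); exact: h.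
Qed.

Lemma retract_zerosumfree P n : zerosumfree R -> retract_row P n -> zerosumfree P.
Proof.
by move=> zR [f [g /can_inj gI]]; apply: (zerosumfree_inj gI (zerosumfree_row zR)).
Qed.

(** Over a division ring [Z] is free and ranks are compared. In the zerosumfree case minimal numbers
    of generators add, and the contribution of [Z] cancels. *)
Lemma row_cancel Z k m n : retract_row Z k ->
  isom (dsum 'rV[R]_m Z) (dsum 'rV[R]_n Z) -> m = n.
Proof.
move=> rZ i; case: ring_or_zerosumfree => [hm|zR].
  have [f [g gK]] := rZ; have [l iZ] := fgproj_free (wcancel_ring hm) gK.
  have iZ' p : isom (dsum 'rV[R]_p Z) 'rV[R]_(p + l).
    exact: isom_trans (isom_dsum (isom_refl _) iZ) (isom_rowD _ _).
  apply/eqP; rewrite -(eqn_add2r l); apply/eqP; apply: mingen_uniq (mingen_row _).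
  apply: mingen_isom (mingen_row _).
  exact: isom_trans (isom_sym (iZ' m)) (isom_trans i (iZ' n)).
have [l hl] := mingen_exists (retract_ngen rZ).
have zZ := retract_zerosumfree zR rZ.
have hD p := mingen_dsum (zerosumfree_row zR) zZ (mingen_row p) hl.
by have /addIn := mingen_uniq (mingen_isom i (hD m)) (hD n).
Qed.

(** * Boolean functionals *)

(* The homomorphisms from M to the Boolean semifield, on which R acts through *)
(* the map sending every nonzero scalar to 1.                                 *)
Definition bool_hom M (h : M -> bool) : Prop :=
  [/\ h 0 = false, forall x y, h (x + y) = h x || h y &
      forall a x, a <> 0 -> h (a *: x) = h x].

Lemma bool_homZ M (h : M -> bool) a x :
  bool_hom h -> h (a *: x) = (a != 0) && h x.
Proof.
case=> h0 _ hZ; case: eqP => [->|/hZ->//]; by rewrite scale0r h0.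
Qed.

Lemma bool_hom_span M (h : M -> bool) n (a : 'I_n -> R) (p : 'I_n -> M) (A : {set 'I_n}) :
  bool_hom h ->
  h (\sum_(i in A) a i *: p i) = [exists i in A, (a i != 0) && h (p i)].
Proof.
move=> hh; have [h0 hD _] := hh; rewrite (big_morph h hD h0) big_orE.
by apply: eq_existsb => i; rewrite bool_homZ.
Qed.

Definition bool_homs M (T : finType) (F : T -> M -> bool) : Prop :=
  injective F /\ forall h, bool_hom h <-> exists t, F t = h.

Definition nbool_hom M n : Prop :=
  exists (T : finType) (F : T -> M -> bool), bool_homs F /\ #|T| = n.

Lemma nbool_hom_uniq M m n : nbool_hom M m -> nbool_hom M n -> m = n.
Proof.
suff le i j : nbool_hom M i -> nbool_hom M j -> (i <= j)%N.
  by move=> h1 h2; apply/eqP; rewrite eqn_leq !le.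
move=> [T [F [[FI hF] <-]]] [T' [F' [[_ hF'] <-]]].
have /choice[f hf] t : exists t', F' t' = F t by apply/hF'/hF; exists t.
by apply: (@leq_card _ _ f) => t t' e; apply: FI; rewrite -!hf e.
Qed.

Lemma nbool_hom_isom M N n : isom M N -> nbool_hom M n -> nbool_hom N n.
Proof.
move=> /isom_linear[f [g [fK gK]]] [T [F [[FI hF] Tn]]].
exists T, (fun t => F t \o g); split=> //; split=> [t t' e|h].
  by apply: FI; apply/funext=> x; have := congr1 (@^~ (f x)) e; rewrite /= fK.
split=> [[h0 hD hZ]|[t <-]].
  have [|t e] := (hF (h \o f)).1.
    split=> [|x y|a x a0] /=; first by rewrite raddf0.
      by rewrite raddfD.
    by rewrite linearZ hZ.
  by exists t; apply/funext=> y; rewrite /= e /= gK.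
have [h0 hD hZ] : bool_hom (F t) by apply/hF; exists t.
split=> [|x y|a x a0] /=; first by rewrite raddf0.
  by rewrite raddfD.
by rewrite linearZ hZ.
Qed.

(** A Boolean functional on a direct sum is the disjunction of its restrictions, which are
    arbitrary. *)
Lemma nbool_hom_dsum M N m n :
  nbool_hom M m -> nbool_hom N n -> nbool_hom (dsum M N) (m * n).
Proof.
move=> [T [F [[FI hF] <-]]] [T' [F' [[FI' hF'] <-]]].
have Fh t : bool_hom (F t) by apply/hF; exists t.
have Fh' t : bool_hom (F' t) by apply/hF'; exists t.
exists (T * T')%type, (fun t u => F t.1 u.1 || F' t.2 u.2); rewrite card_prod.
split=> //; split=> [[t t'] [s s'] e|h].
  congr (_, _); [apply: FI | apply: FI']; apply/funext=> x.
    have := congr1 (@^~ (x, 0)) e; rewrite /=.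
    by case: (Fh' t') => -> _ _; case: (Fh' s') => -> _ _; rewrite !orbF.
  have := congr1 (@^~ (0, x)) e; rewrite /=.
  by case: (Fh t) => -> _ _; case: (Fh s) => -> _ _.
split=> [[h0 hD hZ]|[[t t'] <-]].
  have [|t e] := (hF (fun x => h (x, 0))).1.
    split=> [|x y|a x a0]; first exact: h0.
      by rewrite -hD; congr (h (_, _)); rewrite addr0.
    by rewrite -(hZ a (x, 0) a0); congr (h (_, _)); rewrite scaler0.
  have [|t' e'] := (hF' (fun x => h (0, x))).1.
    split=> [|x y|a x a0]; first exact: h0.
      by rewrite -hD; congr (h (_, _)); rewrite addr0.
    by rewrite -(hZ a (0, x) a0); congr (h (_, _)); rewrite scaler0.
  exists (t, t'); apply/funext=> -[x y] /=; rewrite e e' -hD.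
  by congr (h (_, _)); rewrite ?addr0 ?add0r.
have [h0 hD hZ] := Fh t; have [h0' hD' hZ'] := Fh' t'.
split=> [|x y|a x a0] /=; first by rewrite h0 h0'.
  by rewrite hD hD' orbACA.
by rewrite hZ ?hZ'.
Qed.

(** A functional amounts to a set of coordinates, testing whether a vector is nonzero somewhere on
    it. Zerosumfreeness makes the support of a sum the union of the supports, so each such test is
    additive. *)
Lemma nbool_hom_row n : zerosumfree R -> nbool_hom 'rV[R]_n (2 ^ n).
Proof.
move=> zR; pose F (c : {ffun 'I_n -> bool}) (v : 'rV[R]_n) :=
  [exists i, (v 0 i != 0) && c i].
exists {ffun 'I_n -> bool}, F; split; last by rewrite card_ffun card_bool card_ord.
have Fdelta (c : {ffun _}) i : F c (delta_mx 0 i) = c i.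
  apply/existsP/idP => [[j]|ci]; last first.
    by exists i; rewrite mxE !eqxx ci andbT; apply/eqP; exact: div_oner_neq0.
  by rewrite mxE eqxx /=; case: (j =P i) => [->/andP[]//|_]; rewrite eqxx.
split=> [c c' e|h]; first by apply/ffunP=> i; rewrite -!Fdelta e.
split=> [hh|[c <-]].
  exists [ffun i => h (delta_mx 0 i)]; apply/funext=> v.
  have vE : v = \sum_(i in [set: 'I_n]) v 0 i *: delta_mx 0 i.
    by rewrite {1}[v]row_sum_delta; apply: eq_bigl => i; rewrite inE.
  rewrite [in RHS]vE.
  rewrite (bool_hom_span (v 0) (fun i => delta_mx 0 i)) // /F.
  by apply: eq_existsb => i; rewrite inE ffunE.
split=> [|u v|a v a0].
- by apply/existsP=> -[i]; rewrite mxE eqxx.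
- rewrite /F; apply/existsP/orP => [[i]|].
    rewrite mxE => /andP[uv ci]; case: (u 0 i =P 0) uv => [->|/eqP ui _].
      by rewrite add0r => vi; right; apply/existsP; exists i; rewrite vi.
    by left; apply/existsP; exists i; rewrite ui.
  case=> /existsP[i /andP[/eqP wi ci]]; exists i; rewrite mxE ci andbT; apply/eqP.
    by move/zR.
  by rewrite addrC => /zR.
- apply: eq_existsb => i; rewrite mxE; congr (~~ _ && _).
  apply/eqP/eqP => [/div_mulf_eq0[]//|->]; exact: mulr0.
Qed.

(** Functionals are determined by their values on generators, hence finitely many, and the zero
    functional is one of them. Positivity later allows the factor contributed by [Z] to be
    cancelled. *)
Lemma ngen_bool_homs M n : ngen M n -> exists k, nbool_hom M k /\ (0 < k)%N.
Proof.
case=> p hp.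
pose B := [set w : {ffun 'I_n -> bool} |
             `[< exists h : M -> bool, bool_hom h /\ forall i, h (p i) = w i >]].
have BP (t : {w | w \in B}) : exists h : M -> bool, bool_hom h /\ forall i, h (p i) = val t i.
  by case: t => c /=; rewrite inE => /asboolP.
have [F hF] := choice BP.
have hE (h h' : M -> bool) : bool_hom h -> bool_hom h' ->
    (forall i, h (p i) = h' (p i)) -> h = h'.
  move=> hh hh' e; apply/funext=> x; have [a ->] := hp x.
  by rewrite !bool_hom_span //; apply: eq_existsb => i; rewrite e.
have inB (h : M -> bool) : bool_hom h -> [ffun i => h (p i)] \in B.
  by move=> hh; rewrite inE; apply/asboolP; exists h; split=> // i; rewrite ffunE.
exists #|{: {w | w \in B}}|; split.
  exists {w | w \in B}, F; split=> //; split=> [t t' e|h].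
    by apply/val_inj/ffunP=> i; rewrite -(hF t).2 -(hF t').2 e.
  split=> [hh|[t <-]]; last exact: (hF t).1.
  exists (exist (fun w => w \in B) _ (inB _ hh)); apply: hE => //; first exact: (hF _).1.
  by move=> i; rewrite (hF _).2 /= ffunE.
have h0 : bool_hom (fun _ : M => false) by [].
by apply/card_gt0P; exists (exist (fun w => w \in B) _ (inB _ h0)).
Qed.

(** * A projective semimodule that is not free *)

Lemma wcancelP : (forall c, 1 + 1 = 1 + c -> c = 1) -> wcancel R.
Proof.
move=> h x y e; case: (pselect (x = 0)) => [x0|x0].
  by move: e; rewrite x0 !add0r.
have [b [_ xb bx]] := div_inv x0.
have /h bxy : 1 + 1 = 1 + b * y by rewrite -bx -mulrDr e mulrDr.
by rewrite -[RHS]mul1r -xb -mulrA bxy mulr1.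
Qed.

(** With [h] the inverse of 2, which is central, and [h + h c = 1], the matrix [E] is idempotent,
    and [P] is its row space, with rows [u = (h, h c)] and [v = (h, h)]. Both [u + v] and [v + v]
    equal [(1, 1)], although [c <> 1] prevents [u] from being a multiple of [v]. *)
Lemma nonfree_proj c : zerosumfree R -> 1 + 1 = 1 + c -> c <> 1 ->
  exists P, [/\ retract_row P 2, mingen P 2 &
    forall k, nbool_hom P k -> (k <= 3)%N].
Proof.
move=> zR c2 c1.
have two0 : (1 + 1 : R) <> 0 by move/zR/div_oner_neq0.
have [h [h0 h2 h2']] := div_inv two0.
have hh : h + h = 1 by rewrite -[RHS]h2' mulrDr mulr1.
have hC x : h * x = x * h.
  have x2 : x * (1 + 1) = (1 + 1) * x by rewrite mulrDr mulrDl mulr1 mul1r.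
  by rewrite -[LHS]mulr1 -h2 mulrA -(mulrA h) x2 mulrA h2' mul1r.
have hc : h + h * c = 1 by rewrite -[X in X + _]mulr1 -mulrDr -c2.
pose E : 'M[R]_2 := \matrix_(i, j) if (i == 0) && (j == 1) then h * c else h.
have EE : E *m E = E.
  apply/matrixP=> i j; rewrite !mxE !big_ord_recl big_ord0 addr0 !mxE.
  have hhh : h * h + h * h = h by rewrite -mulrDl hh mul1r.
  have hhc : h * h + h * (h * c) = h by rewrite -mulrDr hc mulr1.
  case: i j => -[|[|//]] ? [[|[|//]] ?] /=; rewrite -?[h * c * h]hC //.
    by rewrite -mulrDl hh mul1r.
  by rewrite addrC.
pose P := fixed (mulmxr E : {linear 'rV[R]_2 -> 'rV[R]_2}).
have fE (x : 'rV[R]_2) : x *m E \in fixed_pred (mulmxr E : {linear 'rV[R]_2 -> 'rV[R]_2}).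
  by rewrite inE /= -mulmxA EE.
pose f x : P := Fixed (fE x).
have lf : semilinear f.
  split=> [a x|x y]; apply: val_inj => /=; first by rewrite scalemxAl.
  by rewrite mulmxDl.
pose g (x : P) := val x : 'rV[R]_2.
have lg : semilinear g by [].
have gK : cancel (mklinear lg) (mklinear lf).
  by move=> [x ex]; apply: val_inj => /=; apply/eqP.
have rP : retract_row P 2 by exists (mklinear lf), (mklinear lg).
pose e i : 'rV[R]_2 := delta_mx 0 i.
have vE i j : val (f (e i)) 0 j = E i j by rewrite /= -rowE mxE.
pose u := f (e 0); pose v := f (e 1).
have uv : u + v = v + v.
  apply/val_inj/rowP=> j; rewrite !raddfD /= ![(_ + _ : 'rV__) _ _]mxE.
  rewrite -!rowE !mxE /=; case: eqP => // _.
  by rewrite addrC hc hh.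
have u_nv b : u <> b *: v.
  move=> ub; have eb j : E 0 j = b * E 1 j.
    by rewrite -!vE -/u ub /= mxE.
  have := eb 0; rewrite !mxE /= => bh.
  have := eb 1; rewrite !mxE /= -bh => hch; apply: c1.
  by rewrite -[LHS]mul1r -h2 -mulrA hch.
have v0 : v <> 0.
  by move=> v0; apply: h0; have := vE 1 0; rewrite -/v v0 /= !mxE /=.
have uv_span (x : P) : exists a b, x = a *: u + b *: v.
  exists (val x 0 0), (val x 0 1).
  have l1 : lift ord0 ord0 = 1 :> 'I_2 by exact: val_inj.
  rewrite -[LHS](gK x) /= [g x]row_sum_delta !big_ord_recl big_ord0 addr0 l1.
  by rewrite lf.2 !lf.1.
exists P; split=> //.
- split; first exact: retract_ngen rP.
  case=> [|[|//]] [p hp].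
    by have [a] := hp v; rewrite big1 // => -[].
  have pE x : exists a, x = a *: p ord0.
    have [a ->] := hp x; exists (a ord0).
    by rewrite (big_pred1 ord0) // => i; rewrite inE (ord1 i).
  have [a ua] := pE u; have [b vb] := pE v.
  have b0 : b <> 0 by move=> b0; apply: v0; rewrite vb b0 scale0r.
  have [b' [_ _ b'b]] := div_inv b0.
  case: (u_nv (a * b')); rewrite vb scalerA -mulrA b'b mulr1; exact: ua.
- move=> k [T [F [[FI hF] <-]]].
  have Fh t : bool_hom (F t) by apply/hF; exists t.
  pose r t : bool * bool := (F t u, F t v).
  have rI : injective r.
    move=> t t' [eu ev]; apply/FI/funext=> x; have [a [b ->]] := uv_span x.
    have [_ -> _] := Fh t; have [_ -> _] := Fh t'.
    by rewrite !bool_homZ ?eu ?ev.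
  (* A functional is determined by its values at [u] and [v], and [u + v = v + v] rules out true at
     [u] with false at [v]. *)
  apply: (@leq_trans #|[set~ (true, false)]|).
    2: by rewrite cardsC1 card_prod card_bool.
  rewrite -(card_codom rI); apply/subset_leq_card/subsetP=> _ /codomP[t ->].
  rewrite !inE /r xpair_eqE; have [_ hD _] := Fh t.
  have := congr1 (F t) uv; rewrite !hD.
  by case: (F t u) (F t v) => [] [].
Qed.

End DivisionSemiring.

(** * Consequences for [SV], [VV] and [jmath] over a division semiring *)

Lemma division_semiring_conv (S : pzSemiRingType) :
  division_semiring S -> division_semiring S^c.
Proof.
case=> h1 hM hV; split=> [|x y x0 y0|x /hV[y [y0 xy yx]]] //; first exact: hM.
by exists y.
Qed.

Section DivisionK0.
Variable D : pzSemiRingType.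
Hypothesis hD : division_semiring D.

Let hR : division_semiring D^c := division_semiring_conv hD.

Lemma fgproj_rowfree (P : rsemimod D) :
  weakly_cancellative D -> fgproj P -> exists n, isom P (rfree D n).
Proof. by move=> wD [n [f [g gK]]]; exact: (@fgproj_free D^c hR P n f g wD gK). Qed.

Lemma fgsproj_rowfree (P : rsemimod D) :
  fgsproj P -> exists n, isom P (rfree D n).
Proof.
move=> hP; case: (ring_or_zerosumfree hR) => [/wcancel_ring wD|zD].
  exact: fgproj_rowfree wD (fgsproj_proj hP).
by have [n [Q hQ]] := hP; exact: (@summand_free D^c hR P Q n zD hQ).
Qed.

(** Both classes are free, so [row_cancel] compares their ranks. The term [z] is the one that the
    equality in [K0] introduces. *)
Lemma SV_V_stably_inj (s t : SV D) (z : VV D) :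
  cm_add (SV_V D s) z = cm_add (SV_V D t) z -> s = t.
Proof.
elim/icls_ind: s => -[P hP]; elim/icls_ind: t => -[Q hQ].
elim/icls_ind: z => -[Z [k hZ]].
rewrite /= !SV_V_funE !icls_addE => /icls_classP /= i.
have [m iP] := fgsproj_rowfree hP; have [n iQ] := fgsproj_rowfree hQ.
have mn : m = n.
  apply: (row_cancel hR hZ); apply: isom_trans (isom_dsum iQ (isom_refl Z)).
  exact: isom_trans (isom_dsum (isom_sym iP) (isom_refl Z)) i.
apply/icls_classP; apply: isom_trans (isom_sym iQ).
by rewrite -mn.
Qed.

Lemma jmath_class p : jmath D (grot_class p) = grot_class (gmap_pair (SV_V D) p).
Proof. exact: gmap_funE. Qed.

Lemma jmath_inj : injective (jmath D).
Proof.
move=> u v; elim/grot_ind: u => p; elim/grot_ind: v => q.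
rewrite !jmath_class => /grot_classP[z e].
have /SV_V_stably_inj pq : cm_add (SV_V D (cm_add p.1 q.2)) z
                         = cm_add (SV_V D (cm_add q.1 p.2)) z.
  by rewrite !cm_funD; exact: e.
by apply/grot_classP; exists (cm_zero _); rewrite pq.
Qed.

Lemma jmath_surj : weakly_cancellative D -> forall w, exists u, jmath D u = w.
Proof.
move=> wD w; elim/grot_ind: w => -[x y].
have lift (c : VV D) : exists s : SV D, SV_V D s = c.
  elim/icls_ind: c => -[P hP]; have [n iP] := fgproj_rowfree wD hP.
  exists (SVclass (fgsproj_rfree D n)); rewrite /= /SVclass SV_V_funE.
  by apply/icls_classP; exact: isom_sym.
have [[s <-] [t <-]] := (lift x, lift y).
by exists (grot_class (s, t)); rewrite jmath_class.
Qed.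

(* If [P] = [D^n] - [D^m] in K_0, comparing minimal numbers of generators      *)
(* gives n = m + 2, whereas counting Boolean functionals gives at most 3 2^m.  *)
Lemma jmath_surj_wcancel :
  (forall w, exists u, jmath D u = w) -> weakly_cancellative D.
Proof.
move=> sj; case: (ring_or_zerosumfree hR) => [/wcancel_ring//|zD].
apply: (wcancelP hR) => c c2; apply: contrapT => c1.
have [P [rP gP bP]] := nonfree_proj hR zD c2 c1.
have hP : fgproj (P : rsemimod D) by exists 2.
have [u] := sj (K0class hP); elim/grot_ind: u => -[s t].
rewrite jmath_class => /grot_classP[z].
elim/icls_ind: z => -[Z hZ]; have [k rZ] := hZ.
elim/icls_ind: s => -[Q hQ]; have [n iQ] := fgsproj_rowfree hQ.
elim/icls_ind: t => -[T hT]; have [m iT] := fgsproj_rowfree hT.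
pose Q' := exist (@fgsproj D) Q hQ; pose T' := exist (@fgsproj D) T hT.
pose P' := exist (@fgproj D) P hP; pose Z' := exist (@fgproj D) Z hZ.
move=> e; have : cm_add (cm_add (icls_class P' : VV D) (SV_V D (icls_class T')))
    (icls_class Z' : VV D) = cm_add (SV_V D (icls_class Q')) (icls_class Z').
  (* The class of [P] in [K0] is a pair with second entry zero, which appears as a zero summand in
     [e]. *)
  by rewrite -(cm_add0 (SV_V D (icls_class Q'))) [cm_add (cm_zero _) _]cm_addC.
rewrite /= !SV_V_funE [icls_add _ (icls_class P') _]icls_addE !icls_addE.
move=> /icls_classP /= {}e.
have i : isom (dsum (dsum P 'rV[D^c]_m) Z) (dsum 'rV[D^c]_n Z).
  apply: isom_trans (isom_dsum iQ (isom_refl Z)); apply: isom_trans e.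
  by apply: isom_dsum (isom_refl Z); apply: isom_dsum (isom_sym iT); exact: isom_refl.
have zZ := retract_zerosumfree zD rZ.
have zr l : zerosumfree 'rV[D^c]_l := zerosumfree_row zD.
have [l gZ] := mingen_exists (retract_ngen rZ).
have gl := mingen_dsum hR (zerosumfree_dsum (retract_zerosumfree zD rP) (zr m)) zZ
  (mingen_dsum hR (retract_zerosumfree zD rP) (zr m) gP (mingen_row hR m)) gZ.
have gr := mingen_dsum hR (zr n) zZ (mingen_row hR n) gZ.
have nE : n = m.+2 by have /addIn := mingen_uniq (mingen_isom i gl) gr.
have [j [bZ j0]] := ngen_bool_homs (retract_ngen rZ).
have [b [bPb _]] := ngen_bool_homs (retract_ngen rP).
have bl := nbool_hom_dsum (nbool_hom_dsum bPb (nbool_hom_row hR m zD)) bZ.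
have br := nbool_hom_dsum (nbool_hom_row hR n zD) bZ.
have /eqP := nbool_hom_uniq (nbool_hom_isom i bl) br.
(* Cancelling the count of [Z] and then [2 ^ m] leaves exactly 4 functionals on [P]. *)
rewrite eqn_pmul2r // nE (expnD 2 2 m) eqn_pmul2r ?expn_gt0 // => /eqP b4.
by have := bP _ bPb; rewrite b4.
Qed.

End DivisionK0.

Theorem theorem6p10 (D : pzSemiRingType) (hD : division_semiring D) :
  injective (jmath D) /\
  (isomorphism (jmath D) <-> weakly_cancellative D).
Proof.
split; first exact: jmath_inj.
split=> [[g _ gK]|wD].
  by apply: (jmath_surj_wcancel hD) => w; exists (g w).
have [g gK] := choice (jmath_surj hD wD).
by exists g => // u; apply: (jmath_inj hD); rewrite gK.
Qed.
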